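(* Let $m,n\ge0$ be integers with $m+n\ge1$. The linear map $\varphi:U_q[osp(2n+1|2m)]\to Cl_q(n|m)$ defined on the generators by $$\varphi(a_i^\pm)=c_i^\pm,\qquad \varphi(H_i)=(-1)^{\langle i\rangle}N_i-\tfrac12,\qquad i=1,\ldots,m+n,$$ and extended to all elements by associativity is a homomorphism of associative superalgebras of $U_q[osp(2n+1|2m)]$ onto $Cl_q(n|m)$.
   Context: Here $h$ is an indeterminate, $q=e^h\in\mathbb{C}[[h]]$, $\bar q=q^{-1}$, and both algebras are topologically free $\mathbb{C}[[h]]$-modules, generated in the topological ($h$-adic) sense. Notation: $N=m+n$; $\langle i\rangle=\bar 1$ for $i\le m$ and $\langle i\rangle=\bar 0$ for $i>m$ (also used as integers $1$, $0$); $[a,b]_x=ab-x\,ba$; $[\![a,b]\!]=ab-(-1)^{\deg(a)\deg(b)}ba$; $[\![a,b]\!]_x=ab-(-1)^{\deg(a)\deg(b)}x\,ba$. $U_q[osp(2n+1|2m)]$ (description by deformed Green generators) is the associative unital superalgebra with generators $H_i,a_i^\pm$, $i=1,\ldots,N$, with $\deg(a_i^\pm)=\langle i\rangle$, $\deg(H_i)=\bar0$, and relations - $[H_i,H_j]=0$, $[H_i,a_j^\pm]=\pm\delta_{ij}(-1)^{\langle i\rangle}a_j^\pm$; - $[\![a_i^-,a_i^+]\!]=-2\,\frac{L_i-\bar L_i}{q-\bar q}$, where $L_i=q^{H_i}$, $\bar L_i=q^{-H_i}$; - $[\,[\![a_{N-1}^\xi,a_N^\xi]\!],a_N^\xi]_{q^{-(-1)^{\langle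 N\rangle}}}=0$, $\xi=\pm$; - $[\![\,[\![a_i^\eta,a_{i+\xi}^{-\eta}]\!],a_j^\eta]\!]_{q^{-\xi(-1)^{\langle i\rangle}\delta_{ij}}}=2\,\eta^{\langle j\rangle}\delta_{j,i+\xi}L_j^{-\xi\eta}a_i^\eta$, for $\xi,\eta=\pm$ (identified with $\pm1$) and all $i,j$ with $i,i+\xi,j\in\{1,\ldots,N\}$. (Relations involving an index outside $\{1,\ldots,N\}$ are absent.) $Cl_q(n|m)$, the deformed Clifford superalgebra, is the associative unital superalgebra with generators $c_i^\pm,N_i$, $i=1,\ldots,N$, with $\deg(c_i^\pm)=\langle i\rangle$, $\deg(N_i)=\bar0$, and relations - $[N_i,N_j]=0$, $[N_i,c_j^\pm]=\pm\delta_{ij}c_j^\pm$; - $c_i^-c_i^+ +(-1)^{\langle i\rangle}q^{\pm1}c_i^+c_i^-=\frac{2}{q^{1/2}+q^{-1/2}}\,q^{\pm(-1)^{\langle i\rangle}N_i}$ (both signs); - $c_i^\xi c_j^\eta=-(-1)^{\langle j\rangle}q^{\xi\eta}c_j^\eta c_i^\xi$ for all $i<j$, $\xi,\eta=\pm$; - $(c_i^\pm)^2=0$ for $i=m+1,\ldots,m+n$. The second family is equivalent to $c_i^+c_i^-=c_q\frac{q^{N_i}-\bar q^{N_i}}{q-\bar q}$ and $c_i^-c_i^+=c_q\frac{q^{1-(-1)^{\langle i\rangle}N_i}-\bar q^{1-(-1)^{\langle i\rangle}N_i}}{q-\bar q}$ with $c_q=\frac{2}{q^{1/2}+q^{-1/2}}$.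 *)

(* Defs.v *)
From HB Require Import structures.
From mathcomp Require Import all_boot all_order all_algebra.
From mathcomp Require Import boolp reals complex.
From mathcomp Require Import finmap.
From mathcomp.multinomials Require Import monalg.

Set Implicit Arguments.
Unset Strict Implicit.
Unset Printing Implicit Defensive.

Import GRing.Theory.

Local Open Scope ring_scope.
Local Open Scope quotient_scope.

(* ------------------------------------------------------------------------ *)
(* V[[h]], for V a Z-module, a ring, or a module over K (K[[h]] then acts).  *)

Record hseries (V : Type) := HSeries { hcoef : nat -> V }.

Section HSeriesZmod.
Variable V : zmodType.
Implicit Types f g : hseries V.

HB.instance Definition _ := gen_eqMixin (hseries V).
HB.instance Definition _ := gen_choiceMixin (hseries V).

Lemma hseriesP f g : hcoef f =1 hcoef g -> f = g.
Proof. by case: f g => [f] [g] /= /funext ->. Qed.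

Definition hs_zero : hseries V := HSeries (fun=> 0).
Definition hs_opp f := HSeries (fun n => - hcoef f n).
Definition hs_add f g := HSeries (fun n => hcoef f n + hcoef g n).

Lemma hs_addA : associative hs_add.
Proof. by move=> f g k; apply: hseriesP => n /=; rewrite addrA. Qed.
Lemma hs_addC : commutative hs_add.
Proof. by move=> f g; apply: hseriesP => n /=; rewrite addrC. Qed.
Lemma hs_add0 : left_id hs_zero hs_add.
Proof. by move=> f; apply: hseriesP => n /=; rewrite add0r. Qed.
Lemma hs_addN : left_inverse hs_zero hs_opp hs_add.
Proof. by move=> f; apply: hseriesP => n /=; rewrite addNr. Qed.

HB.instance Definition _ :=
  GRing.isZmodule.Build (hseries V) hs_addA hs_addC hs_add0 hs_addN.

Lemma hcoefD f g n : hcoef (f + g) n = hcoef f n + hcoef g n.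
Proof. by []. Qed.
Lemma hcoefN f n : hcoef (- f) n = - hcoef f n.
Proof. by []. Qed.
Lemma hcoefB f g n : hcoef (f - g) n = hcoef f n - hcoef g n.
Proof. by []. Qed.

Definition hconst (x : V) : hseries V :=
  HSeries (fun n => if n is 0%N then x else 0).

(* Multiplication by h. *)
Definition hshift f : hseries V :=
  HSeries (fun n => if n is n'.+1 then hcoef f n' else 0).

(* Division by h; the constant coefficient is dropped. *)
Definition hdiv f : hseries V := HSeries (fun n => hcoef f n.+1).

Lemma triangle_sum (F : nat -> nat -> nat -> V) n :
  \sum_(i < n.+1) \sum_(j < (n - i).+1) F i j (n - i - j)%N =
  \sum_(i < n.+1) \sum_(j < i.+1) F j (i - j)%N (n - i)%N.
Proof.
transitivity (\sum_(i < n.+1) \sum_(k < n.+1 | (i <= k)%N)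
                 F i (k - i)%N (n - k)%N).
  apply: eq_bigr => i _.
  transitivity (\sum_(0 + i <= k < n.+1) F i (k - i)%N (n - k)%N).
    rewrite big_addn big_mkord (subSn (leq_ord i)).
    by apply: eq_bigr => j _; rewrite addnK addnC subnDA.
  rewrite add0n (big_nat_widenl _ 0) // big_mkord.
  by apply: eq_bigl => k /=.
rewrite (exchange_big_dep xpredT) //=; apply: eq_bigr => k _.
by rewrite (big_ord_widen _ (fun j => F j (k - j)%N (n - k)%N) (ltn_ord k)).
Qed.

End HSeriesZmod.

Section HSeriesRing.
Variable A : nzRingType.
Implicit Types f g : hseries A.

Definition hs_one : hseries A := hconst 1.
Definition hs_mul f g : hseries A :=
  HSeries (fun n => \sum_(i < n.+1) hcoef f i * hcoef g (n - i)%N).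

Lemma hs_mulA : associative hs_mul.
Proof.
move=> f g k; apply: hseriesP => n /=.
under eq_bigr do rewrite mulr_sumr.
under [RHS]eq_bigr do rewrite mulr_suml.
rewrite (triangle_sum (fun i j l => hcoef f i * (hcoef g j * hcoef k l))).
by apply: eq_bigr => i _; apply: eq_bigr => j _; rewrite mulrA.
Qed.
Lemma hs_mul1l : left_id hs_one hs_mul.
Proof.
move=> f; apply: hseriesP => n /=; rewrite big_ord_recl /= subn0 mul1r.
by rewrite big1 ?addr0 // => i _; rewrite mul0r.
Qed.
Lemma hs_mul1r : right_id hs_one hs_mul.
Proof.
move=> f; apply: hseriesP => n /=; rewrite big_ord_recr /= subnn mulr1.
rewrite big1 ?add0r // => i _.
by rewrite -(subnSK (ltn_ord i)) mulr0.
Qed.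
Lemma hs_mulDl : left_distributive hs_mul +%R.
Proof.
move=> f g k; apply: hseriesP => n /=; rewrite -big_split /=.
by apply: eq_bigr => i _; rewrite mulrDl.
Qed.
Lemma hs_mulDr : right_distributive hs_mul +%R.
Proof.
move=> f g k; apply: hseriesP => n /=; rewrite -big_split /=.
by apply: eq_bigr => i _; rewrite mulrDr.
Qed.
Lemma hs_one_neq0 : hs_one != 0.
Proof.
by apply/eqP => /(congr1 (fun u => hcoef u 0)) /= /eqP; rewrite oner_eq0.
Qed.

HB.instance Definition _ := GRing.Zmodule_isNzRing.Build (hseries A)
  hs_mulA hs_mul1l hs_mul1r hs_mulDl hs_mulDr hs_one_neq0.

Lemma hcoefM f g n :
  hcoef (f * g) n = \sum_(i < n.+1) hcoef f i * hcoef g (n - i)%N.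
Proof. by []. Qed.

End HSeriesRing.

Section HSeriesComRing.
Variable K : comNzRingType.

Lemma hs_mulC : commutative (@GRing.mul (hseries K)).
Proof.
move=> f g; apply: hseriesP => n; rewrite !hcoefM.
rewrite (reindex_inj rev_ord_inj) /=; apply: eq_bigr => i _.
by rewrite subSS (subKn (leq_ord i)) mulrC.
Qed.

HB.instance Definition _ :=
  GRing.PzRing_hasCommutativeMul.Build (hseries K) hs_mulC.

End HSeriesComRing.

Section HSeriesUnit.
Variable K : fieldType.
Implicit Types f g : hseries K.

Fixpoint hs_inv_coefs f n : seq K :=
  if n is n'.+1 then
    let s := hs_inv_coefs f n' in
    rcons s ((hcoef f 0)^-1 *
             ((n' == 0%N)%:R - \sum_(i < n') s`_i * hcoef f (n' - i)%N))
  else [::].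

Definition hs_unit : pred (hseries K) := fun f => hcoef f 0 != 0.
Definition hs_inv f : hseries K :=
  if hs_unit f then HSeries (fun n => (hs_inv_coefs f n.+1)`_n) else f.

Lemma size_hs_inv_coefs f n : size (hs_inv_coefs f n) = n.
Proof. by elim: n => //= n IHn; rewrite size_rcons IHn. Qed.

Lemma nth_hs_inv_coefs f n i : (i < n)%N ->
  (hs_inv_coefs f n)`_i = (hs_inv_coefs f i.+1)`_i.
Proof.
elim: n => // n IHn; rewrite ltnS leq_eqVlt => /predU1P[-> //|lt_in].
by rewrite -(IHn lt_in) [LHS]nth_rcons size_hs_inv_coefs lt_in.
Qed.

Lemma hs_inv_coefsS f n : (hs_inv_coefs f n.+1)`_n =
  (hcoef f 0)^-1 * ((n == 0%N)%:R -
    \sum_(i < n) (hs_inv_coefs f i.+1)`_i * hcoef f (n - i)%N).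
Proof.
rewrite [LHS]nth_rcons size_hs_inv_coefs ltnn eqxx.
by congr (_ * (_ - _)); apply: eq_bigr => i _; rewrite nth_hs_inv_coefs.
Qed.

Lemma hs_mulVf : {in hs_unit, left_inverse 1 hs_inv *%R}.
Proof.
move=> f f_unit; rewrite unfold_in in f_unit.
apply: hseriesP => n; rewrite hcoefM /hs_inv /hs_unit f_unit.
rewrite big_ord_recr subnn -[X in _ + X = _]/((hs_inv_coefs f n.+1)`_n * _).
rewrite hs_inv_coefsS mulrAC mulVf // mul1r addrC subrK.
by case: n.
Qed.

Lemma hs_unitPl f g : g * f = 1 -> hs_unit f.
Proof.
move=> /(congr1 (fun u => hcoef u 0)); rewrite /= big_ord_recl big_ord0 addr0 subnn.
rewrite /hs_unit => gf1; apply/eqP => f0.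
by move/eqP: gf1; rewrite f0 mulr0 eq_sym oner_eq0.
Qed.

Lemma hs_inv_out : {in [predC hs_unit], hs_inv =1 id}.
Proof. by move=> f; rewrite inE unfold_in /hs_inv /hs_unit => /negPf ->. Qed.

HB.instance Definition _ := GRing.ComNzRing_hasMulInverse.Build (hseries K)
  hs_mulVf hs_unitPl hs_inv_out.

End HSeriesUnit.

Section HSeriesLmod.
Variables (K : nzRingType) (V : lmodType K).
Implicit Types (a b : hseries K) (f g : hseries V).

Definition hs_scale a f : hseries V :=
  HSeries (fun n => \sum_(i < n.+1) hcoef a i *: hcoef f (n - i)%N).

Lemma hs_scaleA a b f : hs_scale a (hs_scale b f) = hs_scale (a * b) f.
Proof.
apply: hseriesP => n /=.
under eq_bigr do rewrite scaler_sumr.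
under [RHS]eq_bigr do rewrite scaler_suml.
rewrite (triangle_sum (fun i j l => hcoef a i *: (hcoef b j *: hcoef f l))).
by apply: eq_bigr => i _; apply: eq_bigr => j _; rewrite scalerA.
Qed.
Lemma hs_scale1 : left_id 1 hs_scale.
Proof.
move=> f; apply: hseriesP => n /=; rewrite big_ord_recl /= subn0 scale1r.
by rewrite big1 ?addr0 // => i _; rewrite scale0r.
Qed.
Lemma hs_scaleDr : right_distributive hs_scale +%R.
Proof.
move=> a f g; apply: hseriesP => n /=; rewrite -big_split /=.
by apply: eq_bigr => i _; rewrite scalerDr.
Qed.
Lemma hs_scaleDl f : {morph hs_scale^~ f : a b / a + b}.
Proof.
move=> a b; apply: hseriesP => n /=; rewrite -big_split /=.
by apply: eq_bigr => i _; rewrite scalerDl.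
Qed.

HB.instance Definition _ := GRing.Zmodule_isLmodule.Build (hseries K)
  (hseries V) hs_scaleA hs_scale1 hs_scaleDr hs_scaleDl.

Lemma hcoefZ a f n :
  hcoef (a *: f) n = \sum_(i < n.+1) hcoef a i *: hcoef f (n - i)%N.
Proof. by []. Qed.

End HSeriesLmod.

Section HSeriesLalg.
Variables (K : nzRingType) (A : lalgType K).

Lemma hs_scaleAl (a : hseries K) (f g : hseries A) :
  a *: (f * g) = (a *: f) * g.
Proof.
apply: hseriesP => n; rewrite hcoefZ hcoefM.
under eq_bigr do rewrite hcoefM scaler_sumr.
under [RHS]eq_bigr do rewrite hcoefZ mulr_suml.
rewrite (triangle_sum (fun i j l => hcoef a i *: (hcoef f j * hcoef g l))).
by apply: eq_bigr => i _; apply: eq_bigr => j _; rewrite scalerAl.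
Qed.

HB.instance Definition _ :=
  GRing.Lmodule_isLalgebra.Build (hseries K) (hseries A) hs_scaleAl.

End HSeriesLalg.

(* e^{c h} as a scalar: q ^ c with q = e^h.                                  *)
Definition qpow (K : fieldType) (c : K) : hseries K :=
  HSeries (fun n => (n`!%:R)^-1 * c ^+ n).

(* e^{h X} = q ^ X for X an element of the algebra of coefficients.          *)
Definition qexp (K : fieldType) (A : lalgType K) (X : A) : hseries A :=
  HSeries (fun n => (n`!%:R)^-1 *: X ^+ n).

(* (q^X - q^{-X}) / (q - q^{-1}).  Numerator and denominator both have zero
   constant term; each is divided by h, after which the denominator is
   invertible.                                                               *)
Definition qbox (K : fieldType) (A : lalgType K) (X : A) : hseries A :=
  (hdiv (qpow 1 - qpow (-1) : hseries K))^-1 *: hdiv (qexp X - qexp (- X)).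

(* ------------------------------------------------------------------------ *)
(* Topologically free K[[h]]-algebras given by generators and relations.     *)

Section Presentation.
Variables (K : fieldType) (G : choiceType).

(* The free associative algebra K<G>: the algebra of the free monoid on G.   *)
Definition freealg := {malg K[{fmonom G}]}.
HB.instance Definition _ := GRing.Lalgebra.on freealg.

Definition fgen (x : G) : freealg := mkmalgU (fmu x) 1.

(* K<G>[[h]], the h-adic completion of the free K[[h]]-algebra on G.         *)
Definition tfree := hseries freealg.
HB.instance Definition _ := GRing.Lalgebra.on tfree.

Implicit Types (rel : tfree -> tfree -> Prop) (J : tfree -> Prop).

(* Two-sided ideals of the h-adically complete free algebra that are closed
   for the h-adic topology and have torsion-free quotient: the quotient by
   such an ideal is complete, separated and torsion-free, that is,
   topologically free, and conversely.                                       *)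
Record tf_ideal J : Prop := TfIdeal {
  tf_ideal0 : J 0;
  tf_idealB : forall f g, J f -> J g -> J (f - g);
  tf_idealMl : forall f g, J g -> J (f * g);
  tf_idealMr : forall f g, J f -> J (f * g);
  tf_ideal_closed : forall f,
    (forall n, exists2 g, J g & forall k, (k < n)%N -> hcoef f k = hcoef g k) ->
    J f;
  tf_ideal_sat : forall f, J (hshift f) -> J f
}.

Definition rel_ideal rel : {pred tfree} := fun f : tfree =>
  `[< forall J, tf_ideal J -> (forall u v, rel u v -> J (u - v)) -> J f >].

Lemma rel_ideal_tf rel : tf_ideal (rel_ideal rel).
Proof.
split.
- by apply/asboolP => J [].
- move=> f g /asboolP If /asboolP Ig; apply/asboolP => J JI Jr.
  by apply: (tf_idealB JI); [apply: If | apply: Ig].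
- move=> f g /asboolP Ig; apply/asboolP => J JI Jr.
  by apply: (tf_idealMl JI); apply: Ig.
- move=> f g /asboolP If; apply/asboolP => J JI Jr.
  by apply: (tf_idealMr JI); apply: If.
- move=> f cl; apply/asboolP => J JI Jr; apply: (tf_ideal_closed JI) => n.
  have [g /asboolP Ig fg] := cl n; exists g => //.
  exact: Ig.
- move=> f /asboolP If; apply/asboolP => J JI Jr.
  by apply: (tf_ideal_sat JI); apply: If.
Qed.

Lemma rel_ideal_zmod rel : zmod_closed (rel_ideal rel).
Proof.
have I := rel_ideal_tf rel; split; first exact: (tf_ideal0 I).
by move=> f g; apply: (tf_idealB I).
Qed.

HB.instance Definition _ rel :=
  GRing.isZmodClosed.Build tfree (rel_ideal rel) (rel_ideal_zmod rel).

Definition presented rel := Quotient.quot (rel_ideal rel).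
HB.instance Definition _ rel := GRing.Zmodule.on (presented rel).
HB.instance Definition _ rel := EqQuotient.on (presented rel).

Section Quotient.
Variable rel : tfree -> tfree -> Prop.
Local Notation U := (presented rel).
Local Notation I := (rel_ideal rel).

Definition pres_pi (f : tfree) : U := \pi f.

Lemma pres_piP f g : pres_pi f = pres_pi g <-> I (f - g).
Proof.
split=> [/eqP|If]; first by rewrite -Quotient.idealrBE.
by apply/eqP; rewrite -Quotient.idealrBE.
Qed.

Lemma pres_pi_surj x : exists f, pres_pi f = x.
Proof. by exists (repr x); rewrite /pres_pi reprK. Qed.

Lemma pres_piD : {morph pres_pi : f g / f + g}.
Proof. by move=> f g; rewrite /pres_pi Quotient.pi_add. Qed.

Definition pres_one : U := pres_pi 1.
Definition pres_mul (x y : U) : U := pres_pi (repr x * repr y).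
Definition pres_scale (a : hseries K) (x : U) : U := pres_pi (a *: repr x).

Lemma pres_repr f : I (f - repr (pres_pi f)).
Proof. by apply/pres_piP; rewrite /pres_pi reprK. Qed.

Lemma pres_piM f g : pres_mul (pres_pi f) (pres_pi g) = pres_pi (f * g).
Proof.
have J := rel_ideal_tf rel; apply/esym/pres_piP.
set f' := repr _; set g' := repr _.
rewrite (_ : _ - _ = (f - f') * g - f' * - (g - g')); last first.
  by rewrite mulrBl mulrN mulrBr opprK addrA subrK.
apply: (tf_idealB J); first by apply: (tf_idealMr J); apply: pres_repr.
apply: (tf_idealMl J); rewrite -[- _]add0r.
by apply: (tf_idealB J); [apply: (tf_ideal0 J) | apply: pres_repr].
Qed.

Lemma pres_piZ a f : pres_scale a (pres_pi f) = pres_pi (a *: f).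
Proof.
have J := rel_ideal_tf rel; apply/esym/pres_piP.
rewrite -scalerBr -[X in a *: X]mul1r scalerAl.
by apply: (tf_idealMl J); apply: pres_repr.
Qed.

Ltac lift := repeat match goal with x : U |- _ =>
  case: (pres_pi_surj x) => ? <-; clear x end;
  rewrite ?(pres_piM, pres_piZ, =^~ pres_piD).

Lemma pres_mulA : associative pres_mul.
Proof. by move=> x y z; lift; rewrite mulrA. Qed.
Lemma pres_mul1l : left_id pres_one pres_mul.
Proof. by move=> x; rewrite /pres_one; lift; rewrite mul1r. Qed.
Lemma pres_mul1r : right_id pres_one pres_mul.
Proof. by move=> x; rewrite /pres_one; lift; rewrite mulr1. Qed.
Lemma pres_mulDl : left_distributive pres_mul +%R.
Proof. by move=> x y z; lift; rewrite mulrDl. Qed.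
Lemma pres_mulDr : right_distributive pres_mul +%R.
Proof. by move=> x y z; lift; rewrite mulrDr. Qed.
Lemma pres_scaleA a b x : pres_scale a (pres_scale b x) = pres_scale (a * b) x.
Proof. by lift; rewrite scalerA. Qed.
Lemma pres_scale1 : left_id 1 pres_scale.
Proof. by move=> x; lift; rewrite scale1r. Qed.
Lemma pres_scaleDr : right_distributive pres_scale +%R.
Proof. by move=> a x y; lift; rewrite scalerDr. Qed.
Lemma pres_scaleDl x : {morph pres_scale^~ x : a b / a + b}.
Proof. by move=> a b /=; lift; rewrite scalerDl. Qed.

End Quotient.

(* The quotient might a priori be zero, hence a pzRingType together with an
   lmodType structure and not an lalgType, which requires 1 != 0.            *)
HB.instance Definition _ rel := GRing.Zmodule_isPzRing.Build (presented rel)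
  (@pres_mulA rel) (@pres_mul1l rel) (@pres_mul1r rel)
  (@pres_mulDl rel) (@pres_mulDr rel).
HB.instance Definition _ rel :=
  GRing.Zmodule_isLmodule.Build (hseries K) (presented rel)
  (@pres_scaleA rel) (@pres_scale1 rel) (@pres_scaleDr rel) (@pres_scaleDl rel).

Definition pres_gen rel (x : G) : presented rel := pres_pi rel (hconst (fgen x)).

(* The Z/2-grading for which each generator x has degree deg x. *)
Section Grading.
Variable deg : G -> bool.

Definition word_deg (w : {fmonom G}) : bool := odd (\sum_(x <- w) deg x).

(* Membership in the closure of the span of the words of degree d.           *)
Definition tfree_homog (d : bool) (f : tfree) : Prop :=
  forall n w, w \in msupp (hcoef f n) -> word_deg w = d.

Definition homog rel (d : bool) (x : presented rel) : Prop :=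
  exists2 f, tfree_homog d f & pres_pi rel f = x.

End Grading.

End Presentation.

Arguments pres_gen {K G} rel x.
Arguments homog {K G} deg {rel} d x.

(* ------------------------------------------------------------------------ *)
(* A sign is a boolean, with false for + and true for -, so that the sign s
   is the number (-1) ^+ s; a degree in Z/2 is a boolean as well.            *)

Section Brackets.
Variables (K : fieldType) (A : lalgType K).
Implicit Types (x : hseries K) (u v : hseries A).

(* [u, v]_x *)
Definition qbr x u v := u * v - x *: (v * u).

(* [[u, v]]_x for u, v homogeneous of degrees d, e. *)
Definition sqbr (d e : bool) x u v := qbr ((-1) ^+ (d && e) * x) u v.

End Brackets.

Section Algebras.
Variables (K : fieldType) (m n : nat).
Local Notation N := (m + n)%N.

(* The generators of either algebra: inl i stands for H_i (resp. N_i) and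
   inr (s, i) for a_i^s (resp. c_i^s).  The index i : 'I_(m + n) starts at 0,
   so that it is one less than the usual index and the odd indices are the i
   with i < m.                                                               *)
Definition gens : choiceType := ('I_N + bool * 'I_N)%type.

Definition par (i : 'I_N) : bool := (i < m)%N.

Definition gens_deg (x : gens) : bool :=
  if x is inr (_, i) then par i else false.

Local Notation T := (tfree K gens).
Local Notation cart0 i := (@fgen K gens (inl i)).
Local Notation cart i := (hconst (cart0 i) : T).
Local Notation root s i := (hconst (@fgen K gens (inr (s, i))) : T).
Local Notation sgn b := ((-1) ^+ (nat_of_bool b)).

(* k = i + xi, for a sign xi. *)
Definition is_next (xi : bool) (i k : 'I_N) : bool :=
  if xi then k.+1 == i :> nat else k == i.+1 :> nat.

Inductive osp_rel : T -> T -> Prop :=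
| osp_cart i j :
    osp_rel (qbr 1 (cart i) (cart j)) 0
| osp_weight (s : bool) i j :
    osp_rel (qbr 1 (cart i) (root s j))
            ((sgn s * (i == j)%:R * sgn (par i)) *: root s j)
| osp_diag i :
    osp_rel (sqbr (par i) (par i) 1 (root true i) (root false i))
            (- 2%:R *: qbox (cart0 i))
| osp_serre (xi : bool) (i j : 'I_N) : i.+2 = N -> j.+1 = N ->
    osp_rel (qbr (qpow (- sgn (par j)))
                 (sqbr (par i) (par j) 1 (root xi i) (root xi j))
                 (root xi j))
            0
| osp_triple (xi eta : bool) i k j : is_next xi i k ->
    osp_rel (sqbr (par i (+) par k) (par j)
                  (qpow (- sgn xi * sgn (par i) * (i == j)%:R))
                  (sqbr (par i) (par k) 1 (root eta i) (root (~~ eta) k))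
                  (root eta j))
            ((2%:R * sgn eta ^+ par j * (j == k)%:R) *:
             (qexp ((- sgn xi * sgn eta) *: cart0 j) * root eta i)).

(* c_q = 2 / (q^{1/2} + q^{-1/2})                                            *)
Definition cliff_const : hseries K :=
  2%:R / (qpow 2^-1 + qpow (- 2^-1)).

Inductive cliff_rel : T -> T -> Prop :=
| cliff_cart i j :
    cliff_rel (qbr 1 (cart i) (cart j)) 0
| cliff_weight (s : bool) i j :
    cliff_rel (qbr 1 (cart i) (root s j))
              ((sgn s * (i == j)%:R) *: root s j)
| cliff_diag (s : bool) i :
    cliff_rel (root true i * root false i +
               (sgn (par i) * qpow (sgn s)) *: (root false i * root true i))
              (cliff_const *: qexp ((sgn s * sgn (par i)) *: cart0 i))
| cliff_comm (xi eta : bool) (i j : 'I_N) : (i < j)%N ->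
    cliff_rel (root xi i * root eta j)
              ((- sgn (par j) * qpow (sgn xi * sgn eta)) *:
               (root eta j * root xi i))
| cliff_sq (s : bool) i : ~~ par i ->
    cliff_rel (root s i ^+ 2) 0.

(* U_q[osp(2n+1|2m)] *)
Definition Uq_osp := presented osp_rel.
HB.instance Definition _ := GRing.PzRing.on Uq_osp.
HB.instance Definition _ := GRing.Lmodule.on Uq_osp.
Definition osp_a (s : bool) (i : 'I_N) : Uq_osp :=
  pres_gen osp_rel (inr (s, i)).
Definition osp_H (i : 'I_N) : Uq_osp := pres_gen osp_rel (inl i).
Definition osp_homog (d : bool) (x : Uq_osp) := homog gens_deg d x.

(* Cl_q(n|m) *)
Definition Clq := presented cliff_rel.
HB.instance Definition _ := GRing.PzRing.on Clq.
HB.instance Definition _ := GRing.Lmodule.on Clq.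
Definition cliff_c (s : bool) (i : 'I_N) : Clq :=
  pres_gen cliff_rel (inr (s, i)).
Definition cliff_N (i : 'I_N) : Clq := pres_gen cliff_rel (inl i).
Definition cliff_homog (d : bool) (x : Clq) := homog gens_deg d x.

End Algebras.

Arguments osp_a K {m n} s i.
Arguments osp_H K {m n} i.
Arguments osp_homog {K m n} d x.
Arguments cliff_c K {m n} s i.
Arguments cliff_N K {m n} i.
Arguments cliff_homog {K m n} d x.

(* Main.v *)
(* The substitution H_i -> (-1)^<i> N_i - 1/2, a_i -> c_i is an isomorphism of
   free algebras; extended coefficientwise to power series in h, it descends to
   the presented algebras as soon as the osp relations become consequences of the
   Clifford ones, and it is then onto.  They do: neighbouring generators satisfy
   [[c_i^eta, c_(i+xi)^(-eta)]] = (1 + q^xi) c_i^eta c_(i+xi)^(-eta), and a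
   further bracket with c_j reduces to q-commutation when j <> i + xi and to the
   diagonal Clifford relation when j = i + xi.  The diagonal osp relation follows
   only up to a factor q - q^-1, which can be cancelled since the Clifford algebra
   has no h-torsion.  Uniqueness holds on polynomials in the generators, hence
   everywhere because the target is h-adically separated. *)
From HB Require Import structures.
From mathcomp Require Import all_boot all_order all_algebra.
From mathcomp Require Import boolp reals complex.
From mathcomp Require Import finmap.
From mathcomp.multinomials Require Import monalg.
From mathcomp Require Import zify ring.
Require Import Defs.

Set Implicit Arguments.
Unset Strict Implicit.
Unset Printing Implicit Defensive.

Import GRing.Theory.
Local Open Scope ring_scope.

(** * Free algebras *)

Lemma malg_scaleAr (M : monomType) (R : comNzRingType) (c : R)
    (f g : {malg R[M]}) : c *: (f * g) = f * (c *: g).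
Proof.
apply/malgP => w; rewrite mcoeffZ mcoeffMl.
(* The support of [c *: g] may be smaller than that of [g], so both products are expanded over the
   support of [g]. *)
rewrite (mcoeffMlw w (fsubset_refl _) (msuppZ_le c g)) mulr_sumr.
apply: eq_bigr => v _; rewrite mulr_sumr; apply: eq_bigr => v' _.
by rewrite mcoeffZ mulrnAr mulrCA.
Qed.

Section FreeAlgebra.
Variables (K : fieldType) (G : choiceType).
Local Notation F := (freealg K G).

Lemma fgen_cons x (s : seq G) :
  mkmalgU (FMonom (x :: s)) 1 = fgen K x * mkmalgU (FMonom s) 1 :> F.
Proof.
rewrite /fgen malgM_def fgmulUU mulr1; congr (mkmalgU _ _).
by apply/eqP; rewrite fmP fmM fmU.
Qed.

Lemma malgU_prod (w : {fmonom G}) :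
  mkmalgU w 1 = \prod_(x <- w) fgen K x :> F.
Proof.
case: w; elim=> [|x s IHs]; last by rewrite fgen_cons IHs big_cons.
by rewrite big_nil; congr (mkmalgU _ _); rewrite /one /= fmoneE.
Qed.

Lemma freealgE (f : F) :
  f = \sum_(w <- msupp f) mcoeff w f *: \prod_(x <- w) fgen K x.
Proof.
rewrite [LHS]monalgE; apply: eq_bigr => w _; rewrite -malgU_prod.
by rewrite -mul_malgC malgM_def fgmulUU mulr1 mul1m.
Qed.

Lemma freealg_ind (P : F -> Prop) :
    P 0 -> (forall f g, P f -> P g -> P (f + g)) ->
    (forall c f, P f -> P (c *: f)) ->
    P 1 -> (forall f g, P f -> P g -> P (f * g)) ->
    (forall x, P (fgen K x)) ->
  forall f, P f.
Proof.
move=> P0 PD PZ P1 PM Pg f; rewrite [f]freealgE.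
by apply: big_ind => // w _; apply: PZ; apply: big_ind.
Qed.

HB.instance Definition _ :=
  GRing.Lalgebra_isAlgebra.Build K F (@malg_scaleAr {fmonom G} K).

End FreeAlgebra.

(** * The universal property of the free algebra *)

Section FreeAlgebraLift.
Variables (K : fieldType) (G : choiceType) (A : algType K) (u : G -> A).
Local Notation F := (freealg K G).

Definition lift_word (w : {fmonom G}) : A := \prod_(x <- w) u x.

Lemma lift_word_mmorphism : mmorphism lift_word.
Proof.
split=> [v w|]; rewrite /lift_word; last by rewrite fm1 big_nil.
by rewrite fmM big_cat.
Qed.
HB.instance Definition _ :=
  isMultiplicative.Build {fmonom G} A lift_word lift_word_mmorphism.

(** The algebra morphism extending [u]. It is multiplicative because the scalars of [A] are central,
    so coefficients commute with images of words. *)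
Definition falift : F -> A := mmap (in_alg A) lift_word.

Lemma falift_zmod_morphism : zmod_morphism falift.
Proof. by move=> f g; rewrite /falift raddfB. Qed.

Lemma falift_monoid_morphism : monoid_morphism falift.
Proof.
have [] := @commr_mmap_is_multiplicative {fmonom G} K A (in_alg A) lift_word.
  by move=> f v w; rewrite /GRing.comm /= mulr_algl mulr_algr.
by move=> M1 M2; split.
Qed.

Lemma falift_scalable : scalable falift.
Proof. by move=> c f; rewrite [LHS]mmapZ /= mulr_algl. Qed.

HB.instance Definition _ :=
  GRing.isZmodMorphism.Build F A falift falift_zmod_morphism.
HB.instance Definition _ :=
  GRing.isMonoidMorphism.Build F A falift falift_monoid_morphism.
HB.instance Definition _ :=
  GRing.isScalable.Build K F A *:%R falift falift_scalable.

Lemma falift_gen x : falift (fgen K x) = u x.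
Proof. by rewrite /falift mmapU /= scale1r mul1r /lift_word fmU big_seq1. Qed.

End FreeAlgebraLift.

(** * Power series in h *)

Section HSeriesConst.
Variable A : nzRingType.

Lemma hconst_zmod_morphism : zmod_morphism (@hconst A).
Proof. by move=> x y; apply: hseriesP => -[|n] //=; rewrite subr0. Qed.

Lemma hconst_monoid_morphism : monoid_morphism (@hconst A).
Proof.
split=> // x y; apply: hseriesP => n; rewrite hcoefM big_ord_recl /= subn0.
rewrite big1 ?addr0 => [|i _]; last by rewrite mul0r.
by case: n => //= n; rewrite mulr0.
Qed.

HB.instance Definition _ :=
  GRing.isZmodMorphism.Build A (hseries A) (@hconst A) hconst_zmod_morphism.
HB.instance Definition _ :=
  GRing.isMonoidMorphism.Build A (hseries A) (@hconst A) hconst_monoid_morphism.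

End HSeriesConst.

Section HSeriesAlgebra.
Variables (K : fieldType) (A : algType K).
Implicit Types (a : hseries K) (f g : hseries A).

Lemma hs_scaleAr a f g : a *: (f * g) = f * (a *: g).
Proof.
apply: hseriesP => n; rewrite hcoefZ hcoefM.
under eq_bigr do rewrite hcoefM scaler_sumr.
under [RHS]eq_bigr do rewrite hcoefZ mulr_sumr.
rewrite (triangle_sum (fun i j l => hcoef a i *: (hcoef f j * hcoef g l))).
rewrite (triangle_sum (fun i j l => hcoef f i * (hcoef a j *: hcoef g l))).
apply: eq_bigr => i _.
(* Reversing the inner index exchanges the degrees of [a] and [f], which matches the two triple
   sums. *)
rewrite (reindex_inj rev_ord_inj) /=; apply: eq_bigr => j _.
by rewrite subSS (subKn (leq_ord j)) scalerAr.
Qed.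

HB.instance Definition _ :=
  GRing.Lalgebra_isAlgebra.Build (hseries K) (hseries A) hs_scaleAr.

Lemma hcoefZ_const (c : K) f n : hcoef (hconst c *: f) n = c *: hcoef f n.
Proof.
rewrite hcoefZ big_ord_recl /= subn0 big1 ?addr0 // => i _.
by rewrite scale0r.
Qed.

Lemma hconstZ (c : K) (x : A) : hconst (c *: x) = hconst c *: hconst x.
Proof. by apply: hseriesP => -[|n]; rewrite hcoefZ_const //= scaler0. Qed.

Lemma hconst_affine (s c : K) (x : A) :
  hconst (s *: x - c%:A) = hconst s *: hconst x - (hconst c)%:A.
Proof. by rewrite raddfB /= !hconstZ rmorph1. Qed.

Definition hvar : hseries K := hshift 1.

Lemma hcoefZ_var f n :
  hcoef (hvar *: f) n = if n is n'.+1 then hcoef f n' else 0.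
Proof.
rewrite hcoefZ big_ord_recl /= scale0r add0r.
case: n => [|n]; first by rewrite big_ord0.
rewrite big_ord_recl /= subSS subn0 scale1r big1 ?addr0 // => i _.
by rewrite scale0r.
Qed.

Lemma hshiftE f : hshift f = hvar *: f.
Proof. by apply: hseriesP => n; rewrite hcoefZ_var. Qed.

Lemma hdivE f : f = hconst (hcoef f 0) + hvar *: hdiv f.
Proof.
apply: hseriesP => n; rewrite hcoefD hcoefZ_var.
by case: n => [|n] /=; rewrite ?addr0 ?add0r.
Qed.

(** Taylor expansion with remainder: modulo a multiple of [h^n] a series is a finite combination of
    constants, which is how h-adic arguments reduce to coefficients. *)
Lemma hs_expansion f n :
  f = \sum_(k < n) hvar ^+ k *: hconst (hcoef f k) +
      hvar ^+ n *: HSeries (fun k => hcoef f (n + k)%N).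
Proof.
elim: n => [|n IHn]; first by rewrite big_ord0 expr0 scale1r add0r; case: f.
rewrite [LHS]IHn big_ord_recr -addrA [in X in _ + X = _](hdivE (HSeries _)).
rewrite scalerDr scalerA -exprSr /= addn0.
congr (_ + (_ + _ *: _)).
by apply: hseriesP => k /=; rewrite addnS.
Qed.

Lemma hcoefZ_varn f n k : (k < n)%N -> hcoef (hvar ^+ n *: f) k = 0.
Proof.
elim: n k => // n IHn k lt_kn; rewrite exprS -scalerA hcoefZ_var.
by case: k lt_kn => // k; apply: IHn.
Qed.

End HSeriesAlgebra.

(** * Coefficientwise extension of algebra morphisms to power series *)

Section HSeriesMap.
Variables (K : fieldType) (A B : algType K) (h : {lrmorphism A -> B}).

Definition hmap (f : hseries A) : hseries B := HSeries (fun n => h (hcoef f n)).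

Lemma hmap_zmod_morphism : zmod_morphism hmap.
Proof. by move=> f g; apply: hseriesP => n /=; rewrite raddfB. Qed.

Lemma hmap_monoid_morphism : monoid_morphism hmap.
Proof.
split=> [|f g]; apply: hseriesP => n /=.
  by case: n => [|n]; rewrite ?rmorph1 ?rmorph0.
by rewrite rmorph_sum; apply: eq_bigr => i _; rewrite rmorphM.
Qed.

Lemma hmap_scalable : scalable hmap.
Proof.
move=> a f; apply: hseriesP => n /=.
by rewrite rmorph_sum; apply: eq_bigr => i _ /=; rewrite linearZ.
Qed.

HB.instance Definition _ :=
  GRing.isZmodMorphism.Build (hseries A) (hseries B) hmap hmap_zmod_morphism.
HB.instance Definition _ :=
  GRing.isMonoidMorphism.Build (hseries A) (hseries B) hmap
    hmap_monoid_morphism.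
HB.instance Definition _ :=
  GRing.isScalable.Build (hseries K) (hseries A) (hseries B) *:%R hmap
    hmap_scalable.

Lemma hmap_const x : hmap (hconst x) = hconst (h x).
Proof. by apply: hseriesP => -[|n] /=; rewrite ?rmorph0. Qed.

Lemma hmap_qexp X : hmap (qexp X) = qexp (h X).
Proof. by apply: hseriesP => n /=; rewrite linearZ /= rmorphXn. Qed.

End HSeriesMap.

(** * Exponentials of h and q-numbers in characteristic zero *)

Section QExp.
Variables (K : fieldType) (charK : [pchar K] =i pred0).

Lemma fact_neq0 k : k`!%:R != 0 :> K.
Proof. by have /pcharf0P-> := charK; rewrite -lt0n fact_gt0. Qed.

Lemma qexpD (A : algType K) (X Y : A) :
  GRing.comm X Y -> qexp (X + Y) = qexp X * qexp Y.
Proof.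
move=> cXY; apply: hseriesP => n /=; rewrite addrC exprDn_comm //.
rewrite scaler_sumr; apply: eq_bigr => i _ /=.
have -> : Y ^+ (n - i) * X ^+ i = X ^+ i * Y ^+ (n - i).
  exact/commrX/commr_sym/commrX.
rewrite -scalerAl -scalerAr scalerA -scaler_nat scalerA; congr (_ *: _).
(* The binomial coefficient over [n!] equals [1 / (i! (n - i)!)]; this is where the factorials must
   be invertible. *)
have /(congr1 (fun k => k%:R : K)) := bin_fact (leq_ord i).
rewrite !natrM => En; have nz := mulf_neq0 (fact_neq0 i) (fact_neq0 (n - i)).
by apply: (mulIf nz); rewrite -invfM mulVf // -mulrA En mulVf ?fact_neq0.
Qed.

Lemma qexp_scalar (A : algType K) (c : K) :
  qexp c%:A = (qpow c)%:A :> hseries A.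
Proof.
apply: hseriesP => n; rewrite hcoefZ big_ord_recr /= subnn.
rewrite big1 ?add0r => [|i _].
  by rewrite exprZn expr1n scalerA.
by rewrite -(subnSK (ltn_ord i)) scaler0.
Qed.

Lemma qexpD_scalar (A : algType K) (X : A) (c : K) :
  qexp (X + c%:A) = qpow c *: qexp X.
Proof.
rewrite qexpD ?qexp_scalar ?mulr_algr //.
by rewrite /GRing.comm mulr_algl mulr_algr.
Qed.

Lemma qpowD (a b : K) : qpow (a + b) = qpow a * qpow b.
Proof. exact: (@qexpD K^o a b (mulrC a b)). Qed.

Lemma qpow0 : qpow 0 = 1 :> hseries K.
Proof.
apply: hseriesP => -[|n] /=; first by rewrite fact0 invr1 mul1r.
by rewrite expr0n mulr0.
Qed.

Lemma qpowK (a : K) : qpow a * qpow (- a) = 1.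
Proof. by rewrite -qpowD subrr qpow0. Qed.

(** The series [q - q^-1] starts with [2h], so it is [h] times a unit; cancelling it amounts to
    cancelling [h]. *)
Lemma qdiffE :
  exists2 d : hseries K, d \is a GRing.unit &
    d = hdiv (qpow 1 - qpow (-1)) /\ qpow 1 - qpow (-1) = hvar K * d.
Proof.
set d := qpow 1 - qpow (-1); exists (hdiv d); last split=> //.
  rewrite unfold_in /= /hs_unit /= !expr1 mulrN opprK -[1`!]/1%N invr1 mulr1.
  by have /pcharf0P/(_ 2%N) := charK => ->.
have := @hdivE K K^o d.
by rewrite /= !expr0 subrr [hconst 0](raddf0 (@hconst K^o)) add0r.
Qed.

Lemma qboxE (A : algType K) (X : A) :
  (qpow 1 - qpow (-1)) *: qbox X = qexp X - qexp (- X).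
Proof.
have [d dU [Ed ->]] := qdiffE; have Eq := hdivE (qexp X - qexp (- X)).
rewrite [hcoef _ 0]/= !expr0 subrr raddf0 add0r in Eq.
by rewrite [in RHS]Eq /qbox -Ed scalerA mulrK.
Qed.

Lemma hcoef_qexp_comm (A : algType K) (t : K) (x y : A) k :
  hcoef (qexp (t *: x) * hconst y - hconst y * qexp (t *: x)) k =
  (k`!%:R^-1 * t ^+ k) *: (x ^+ k * y - y * x ^+ k).
Proof.
rewrite hcoefB !hcoefM big_ord_recr /= subnn big1 ?add0r => [|i _]; last first.
  by rewrite -(subnSK (ltn_ord i)) mulr0.
rewrite big_ord_recl big1 ?addr0 => [|i _]; last by rewrite mul0r.
by rewrite subn0 exprZn scalerA -scalerAl -scalerAr -scalerBr.
Qed.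

End QExp.

(** Central terms drop out of commutators, so the shift by 1/2 in the image of [H_i] is felt only by
    exponentials. *)
Lemma comm_affine (K : nzRingType) (A : algType K) (s c : K) (x y : A) :
  (s *: x - c%:A) * y - y * (s *: x - c%:A) = s *: (x * y - y * x).
Proof.
rewrite mulrBl mulrBr -!scalerAl -!scalerAr mul1r mulr1 scalerBr opprB addrA.
by rewrite subrK.
Qed.

Lemma scale_affine (K : nzRingType) (A : algType K) (s s' c : K) (x : A) :
  s *: (s' *: x - c%:A) = (s * s') *: x + (- (s * c))%:A.
Proof. by rewrite scalerBr !scalerA scaleNr. Qed.

(** * Presented algebras *)

Lemma rmorph_commX (R R' : pzRingType) (f : {rmorphism R -> R'}) x y k :
  f x * f y = f y * f x -> f (x ^+ k * y - y * x ^+ k) = 0.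
Proof.
move=> cxy; rewrite rmorphB !rmorphM rmorphXn; apply/eqP.
by rewrite subr_eq0 eq_sym; apply/eqP/commrX/esym.
Qed.

Section Presented.
Variables (K : fieldType) (G : choiceType).
Variable rel : tfree K G -> tfree K G -> Prop.
Local Notation F := (freealg K G).
Local Notation T := (hseries F).
Local Notation U := (presented rel).
Local Notation pi := (pres_pi rel : T -> U).

Lemma pres_pi_zmod_morphism : zmod_morphism pi.
Proof.
move=> f g; apply: (canRL (addrK _)).
by rewrite -[LHS](pres_piD rel) subrK.
Qed.

Lemma pres_pi_monoid_morphism : monoid_morphism pi.
Proof. by split=> [|f g]; last exact: esym (pres_piM rel f g). Qed.

Lemma pres_pi_scalable : scalable pi.
Proof. by move=> a f; exact: esym (pres_piZ rel a f). Qed.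

Lemma pres_piMr (f g : T) : pi (f * g) = pi f * pi g.
Proof. exact: pres_pi_monoid_morphism.2. Qed.

HB.instance Definition _ :=
  GRing.isZmodMorphism.Build T U pi pres_pi_zmod_morphism.
HB.instance Definition _ :=
  GRing.isMonoidMorphism.Build T U pi pres_pi_monoid_morphism.
HB.instance Definition _ :=
  GRing.isScalable.Build (hseries K) T U *:%R pi pres_pi_scalable.

Lemma pres_scaleAl (a : hseries K) (x y : U) : a *: (x * y) = (a *: x) * y.
Proof.
have [f <-] := pres_pi_surj x; have [g <-] := pres_pi_surj y.
by rewrite -rmorphM -!linearZ -rmorphM scalerAl.
Qed.

Lemma pres_scaleAr (a : hseries K) (x y : U) : a *: (x * y) = x * (a *: y).
Proof.
have [f <-] := pres_pi_surj x; have [g <-] := pres_pi_surj y.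
by rewrite -rmorphM -!linearZ -rmorphM scalerAr.
Qed.

Lemma pres_pi_eq0 (f : T) : pi f = 0 <-> rel_ideal rel f.
Proof. by have := pres_piP rel f 0; rewrite raddf0 subr0. Qed.

Lemma pres_pi_rel (u v : T) : rel u v -> pi u = pi v.
Proof. by move=> uv; apply/pres_piP/asboolP => J _ /(_ u v uv). Qed.

Lemma pres_pi_qbr a (u v : T) :
  pi (qbr a u v) = pi u * pi v - a *: (pi v * pi u).
Proof.
rewrite /qbr pres_pi_zmod_morphism pres_pi_scalable.
exact: (congr2 (fun x y => x - a *: y) (pres_piMr u v) (pres_piMr v u)).
Qed.

Lemma pres_pi_const_comm (x y : F) :
  pi (hconst (x * y - y * x)) = pi (qbr 1 (hconst x) (hconst y)).
Proof.
rewrite /qbr scale1r (raddfB (@hconst F)) /=; congr pres_pi.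
have M := rmorphM (@hconst F).
exact: (congr2 (fun u v => u - v) (M x y) (M y x)).
Qed.

Lemma pres_pi_lin2 a (u v u' v' : T) :
  pi (u * v + a *: (u' * v')) = pi u * pi v + a *: (pi u' * pi v').
Proof.
rewrite pres_piD pres_pi_scalable.
exact: (congr2 (fun x y => x + a *: y) (pres_piMr u v) (pres_piMr u' v')).
Qed.

Lemma pres_piZM a (u v : T) : pi (a *: (u * v)) = a *: (pi u * pi v).
Proof. by rewrite pres_pi_scalable pres_piMr. Qed.

Lemma pres_pi_affine a b (f : T) :
  pi (a *: f - b%:A) = a *: pi f - b *: (1 : U).
Proof.
by rewrite pres_pi_zmod_morphism !pres_pi_scalable (rmorph1 (pres_pi rel)).
Qed.

(** Saturation of the relation ideal says precisely that the quotient has no h-torsion. *)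
Lemma pres_hvar_inj (x : U) : hvar K *: x = 0 -> x = 0.
Proof.
have [f <-] := pres_pi_surj x; rewrite -linearZ -hshiftE => /pres_pi_eq0.
by move/(tf_ideal_sat (rel_ideal_tf rel))/pres_pi_eq0.
Qed.

Lemma pres_qexpD_scalar (charK : [pchar K] =i pred0) (x : F) (a : K) :
  pi (qexp (x + a%:A)) = qpow a *: pi (qexp x).
Proof. by rewrite -pres_pi_scalable; congr pres_pi; apply: qexpD_scalar. Qed.

Lemma pres_qdiff_inj (charK : [pchar K] =i pred0) (x : U) :
  (qpow 1 - qpow (-1)) *: x = 0 -> x = 0.
Proof.
have [d dU [_ ->]] := qdiffE charK; rewrite -scalerA => /pres_hvar_inj dx0.
by rewrite -[x]scale1r -(mulVr dU) -scalerA dx0 scaler0.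
Qed.

(** Closedness of the relation ideal makes the quotient h-adically separated. *)
Lemma pres_separated (x : U) :
  (forall n, exists y, x = hvar K ^+ n *: y) -> x = 0.
Proof.
have [f <-] := pres_pi_surj x => x_div; apply/pres_pi_eq0.
apply: (tf_ideal_closed (rel_ideal_tf rel)) => n; have [y] := x_div n.
have [g <-] := pres_pi_surj y; rewrite -linearZ /= => /pres_piP Jfg.
(* This element of the ideal agrees with [f] below degree [n]. *)
by exists (f - hvar K ^+ n *: g) => // k ?; rewrite hcoefB hcoefZ_varn ?subr0.
Qed.

Lemma pres_pi_coef_eq0 (f : T) :
  (forall n, pi (hconst (hcoef f n)) = 0) -> pi f = 0.
Proof.
move=> f0; apply: pres_separated => n; rewrite {1}(hs_expansion f n).
rewrite raddfD raddf_sum big1 ?add0r => [|k _]; last first.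
  by rewrite [LHS]linearZ /= f0 scaler0.
by eexists; apply: linearZ.
Qed.

(** Since [x] and [y] commute only in the quotient, the commutator of the exponential with [y] is
    killed there one coefficient at a time. *)
Lemma pres_qexp_comm (t : K) (x y : F) :
  pi (hconst x) * pi (hconst y) = pi (hconst y) * pi (hconst x) ->
  pi (qexp (t *: x)) * pi (hconst y) = pi (hconst y) * pi (qexp (t *: x)).
Proof.
move=> cxy; pose pc := pi \o @hconst F : {rmorphism F -> U}.
have cX k : pc (x ^+ k * y - y * x ^+ k) = 0.
  by apply: (rmorph_commX (f := pc)); exact: cxy.
transitivity (pi (qexp (t *: x) * hconst y)); first exact/esym/pres_piMr.
transitivity (pi (hconst y * qexp (t *: x))); last exact: pres_piMr.
apply/pres_piP/pres_pi_eq0/pres_pi_coef_eq0 => k.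
rewrite hcoef_qexp_comm hconstZ pres_pi_scalable.
by rewrite -[pi (hconst _)]/(pc _) cX scaler0.
Qed.

End Presented.

(** * Descent of morphisms to presented algebras *)

Section PresentedMap.
Variables (K : fieldType) (G G' : choiceType).
Variable rel : tfree K G -> tfree K G -> Prop.
Variable rel' : tfree K G' -> tfree K G' -> Prop.
Variable h : {lrmorphism freealg K G -> freealg K G'}.
Local Notation T := (hseries (freealg K G)).

Lemma pres_hmap_qbr a (u v : T) x y :
  pres_pi rel' (hmap h u) = x -> pres_pi rel' (hmap h v) = y ->
  pres_pi rel' (hmap h (qbr a u v)) = x * y - a *: (y * x).
Proof.
move=> <- <-; rewrite -pres_pi_qbr; congr pres_pi.
rewrite /qbr raddfB /= linearZ /=; have M := rmorphM (hmap h).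
exact: (congr2 (fun x y => x - a *: y) (M u v) (M v u)).
Qed.

Lemma pres_hmapZM a (u v : T) x y :
  pres_pi rel' (hmap h u) = x -> pres_pi rel' (hmap h v) = y ->
  pres_pi rel' (hmap h (a *: (u * v))) = a *: (x * y).
Proof.
move=> <- <-; rewrite linearZ pres_pi_scalable; congr (_ *: _).
by rewrite -pres_piMr; congr pres_pi; apply: (rmorphM (hmap h)).
Qed.

Lemma pres_hmap0 : pres_pi rel' (hmap h 0) = 0.
Proof. by rewrite !raddf0. Qed.

Lemma pres_hmapZ a (u : T) x : pres_pi rel' (hmap h u) = x ->
  pres_pi rel' (hmap h (a *: u)) = a *: x.
Proof. by move=> <-; rewrite linearZ pres_pi_scalable. Qed.

Lemma pres_hmap_comm (x y : freealg K G) :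
  pres_pi rel' (hmap h (qbr 1 (hconst x) (hconst y))) =
  pres_pi rel' (hconst (h x * h y - h y * h x)).
Proof.
rewrite (pres_hmap_qbr _ erefl erefl) !hmap_const.
by rewrite pres_pi_const_comm pres_pi_qbr.
Qed.

Lemma pres_hmap_qbox (charK : [pchar K] =i pred0) (x : freealg K G) :
  (qpow 1 - qpow (-1)) *: pres_pi rel' (hmap h (qbox x)) =
  pres_pi rel' (hmap h (qexp x)) - pres_pi rel' (hmap h (qexp (- x))).
Proof.
rewrite -(pres_hmapZ _ erefl) qboxE // raddfB /=; exact: pres_pi_zmod_morphism.
Qed.

(** The series with zero image form an ideal, closed because the target is separated and saturated
    because it is torsion-free; hence it contains the ideal generated by [rel]. *)
Lemma pres_map_kernel :
    (forall u v, rel u v ->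
       pres_pi rel' (hmap h u) = pres_pi rel' (hmap h v)) ->
  forall f : T, pres_pi rel f = 0 -> pres_pi rel' (hmap h f) = 0.
Proof.
move=> hrel f /pres_pi_eq0/asboolP Jf; 
apply: (Jf (fun f => pres_pi rel' (hmap h f) = 0)) => [|u v /hrel]; last first.
  by rewrite !raddfB /= => ->; rewrite subrr.
split=> [|u v Ju Jv|u v Jv|u v Ju|u u_lim|u].
- by rewrite !rmorph0.
- by rewrite !raddfB /= Ju Jv subrr.
- by rewrite !rmorphM /= Jv mulr0.
- by rewrite !rmorphM /= Ju mul0r.
- apply: pres_separated => n; have [v Jv uv] := u_lim n.
  exists (pres_pi rel' (hmap h (HSeries (fun k => hcoef (u - v) (n + k)%N)))).
  (* The image of [v] is zero, so [u] may be replaced by [u - v], which is divisible by [h^n]. *)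
  rewrite -[LHS]subr0 -[X in _ - X]Jv -!linearZ -!raddfB /=.
  rewrite [u - v in LHS](hs_expansion _ n) big1 ?add0r //.
  by move=> k _; rewrite hcoefB uv ?subrr ?raddf0 ?scaler0.
- by rewrite hshiftE !linearZ; apply: pres_hvar_inj.
Qed.

Lemma pres_map_exists :
    (forall u v, rel u v ->
       pres_pi rel' (hmap h u) = pres_pi rel' (hmap h v)) ->
  exists2 phi : {rmorphism presented rel -> presented rel'}, scalable phi &
    forall f : T, phi (pres_pi rel f) = pres_pi rel' (hmap h f).
Proof.
move=> hrel; pose p (x : presented rel) := pres_pi rel' (hmap h (repr x)).
have pE (f : T) : p (pres_pi rel f) = pres_pi rel' (hmap h f).
  apply/esym/eqP; rewrite -subr_eq0 -!raddfB; apply/eqP/pres_map_kernel => //.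
  exact/pres_pi_eq0/pres_repr.
have pB : zmod_morphism p.
  move=> x y; have [f <-] := pres_pi_surj x; have [g <-] := pres_pi_surj y.
  by rewrite -raddfB !pE !raddfB.
have pM : monoid_morphism p.
  split=> [|x y]; first by rewrite -(rmorph1 (pres_pi rel)) pE !rmorph1.
  have [f <-] := pres_pi_surj x; have [g <-] := pres_pi_surj y.
  by rewrite -rmorphM !pE !rmorphM.
pose pBi := GRing.isZmodMorphism.Build _ _ p pB.
pose pMi := GRing.isMonoidMorphism.Build _ _ p pM.
pose phi : {rmorphism _ -> _} := HB.pack p pBi pMi.
exists phi => // a x; have [f <-] := pres_pi_surj x.
by rewrite -linearZ /= !pE !linearZ.
Qed.

End PresentedMap.

(** * q-commutation calculus *)

(* The product is kept abstract because [presented rel] is not known to be nonzero,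
   so that it has no [algType] structure. *)
Section QCommutation.
Variables (S : comNzRingType) (A : lmodType S) (mul : A -> A -> A).
Local Notation "x '**' y" := (mul x y) (at level 40, left associativity).
Hypotheses (mA : associative mul) (mDr : right_distributive mul +%R).
Hypothesis mZl : forall (a : S) (x y : A), a *: (x ** y) = (a *: x) ** y.
Hypothesis mZr : forall (a : S) (x y : A), a *: (x ** y) = x ** (a *: y).
Implicit Types (a t u : S) (b : bool) (x y z w : A).
Local Notation sgn b := ((-1) ^+ (nat_of_bool b)).

Lemma sgnK b : sgn b * sgn b = 1 :> S.
Proof. by rewrite -expr2 sqrr_sign. Qed.

Lemma qswap_sym b t u x y :
  t * u = 1 -> y ** x = (- sgn b * t) *: (x ** y) ->
  x ** y = (- sgn b * u) *: (y ** x).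
Proof.
move=> tu ->; rewrite scalerA mulrACA mulrNN sgnK mul1r [u * t]mulrC tu.
by rewrite scale1r.
Qed.

Lemma qsum_sym b t u x y w :
  t * u = 1 -> y ** x + (sgn b * t) *: (x ** y) = w ->
  x ** y + (sgn b * u) *: (y ** x) = (sgn b * u) *: w.
Proof.
move=> tu <-; rewrite scalerDr scalerA mulrACA sgnK mul1r [u * t]mulrC tu.
by rewrite scale1r addrC.
Qed.

Lemma qbr_scale a t x y :
  (a *: x) ** y - t *: (y ** (a *: x)) = a *: (x ** y - t *: (y ** x)).
Proof.
by rewrite scalerBr -mZl -mZr !scalerA [a * t]mulrC.
Qed.

Lemma qbr_swap b t x y : y ** x = (- sgn b * t) *: (x ** y) ->
  x ** y - sgn b *: (y ** x) = (1 + t) *: (x ** y).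
Proof.
move=> ->; rewrite scalerA mulNr mulrN mulrA sgnK mul1r scaleNr opprK.
by rewrite scalerDl scale1r.
Qed.

(** Case [j = k] of the triple relation: moving [z] past [x] leaves the left side of a diagonal
    Clifford relation. *)
Lemma triple_next (p p' : bool) t x y z :
  z ** x = (- sgn (p && p') * t) *: (x ** z) ->
  x ** y ** z - sgn ((p (+) p') && p') *: (z ** (x ** y)) =
  x ** (y ** z + (sgn p' * t) *: (z ** y)).
Proof.
move=> zx; rewrite mA zx -mZl scalerA mDr -mZr !mA mulrA mulrN mulNr.
rewrite scaleNr opprK.
congr (_ + (_ * t) *: _).
by case: p p' {zx} => [] []; rewrite /= ?expr1 ?expr0 ?mulN1r ?mul1r ?opprK.
Qed.

(** Case [j = i]: for even [x] the square vanishes, for odd [x] the deformation parameter [u] is the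
    commutation factor [t]. *)
Lemma triple_same (p p' : bool) t u x y :
  y ** x = (- sgn (p && p') * t) *: (x ** y) ->
  (~~ p -> x ** x = 0) -> (p -> t = u) ->
  x ** y ** x - (sgn ((p (+) p') && p) * u) *: (x ** (x ** y)) = 0.
Proof.
move=> yx xx tu; rewrite -mA yx -mZr mA.
case: p tu xx {yx} => [-> // _|_ -> //]; last first.
  (* A product with 0 is 0 because the scalar 0 can be pulled out of it. *)
  by rewrite -(scale0r 0) -mZl !scale0r !scaler0 subrr.
by case: p'; rewrite /= ?expr1 ?expr0 ?opprK subrr.
Qed.

(** Case of three distinct indices: the factors met when passing [y] and then [x] are inverse to
    each other. *)
Lemma triple_other (p p' p'' : bool) t u x y z :
  y ** z = (- sgn (p' && p'') * t) *: (z ** y) ->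
  x ** z = (- sgn (p && p'') * u) *: (z ** x) -> t * u = 1 ->
  x ** y ** z - sgn ((p (+) p') && p'') *: (z ** (x ** y)) = 0.
Proof.
move=> yz xz tu; rewrite -mA yz -mZr mA xz -mZl scalerA mulrACA mulrNN.
rewrite tu mulr1 -mA.
apply/eqP; rewrite subr_eq0; apply/eqP; congr (_ *: _).
by case: p p' p'' {yz xz} => [] [] [];
  rewrite /= ?expr1 ?expr0 ?mulN1r ?mul1r ?opprK.
Qed.

Lemma serre_swap b (p : bool) t u x y :
  x ** y = (- sgn b * t) *: (y ** x) ->
  (~~ p -> y ** y = 0) -> (p -> b /\ t = u) ->
  (x ** y - sgn b *: (y ** x)) ** y -
    u *: (y ** (x ** y - sgn b *: (y ** x))) = 0.
Proof.
move=> xy yy bt; rewrite xy -scalerBl qbr_scale -mA xy -mZr [y ** (y ** x)]mA.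
case: p yy bt => [_ []// -> ->|-> // _]; last first.
  by rewrite -(scale0r 0) -mZl !scale0r !scaler0 subrr scaler0.
by rewrite expr1 opprK mul1r subrr scaler0.
Qed.

(* With [q = r ^+ 2], [x = c^- c^+] and [y = c^+ c^-]: the two diagonal Clifford
   relations, linear in [x] and [y], give the diagonal relation of osp up to the
   factor [q - q^{-1}]. *)
Lemma diag_qbox b c r r' x y w w' :
  r * r' = 1 -> c * (r + r') = 2 ->
  x + (sgn b * (r * r)) *: y = c *: w ->
  x + (sgn b * (r' * r')) *: y = c *: w' ->
  (r * r - r' * r') *: (x - sgn b *: y) = (- 2) *: (r' *: w - r *: w').
Proof.
move=> rr' c2 E E'.
(* With these weights the left sides combine to a multiple of the bracket, and on the right
   [r^2 + 1 = r (r + r')] absorbs [c], leaving [2 r]; likewise for [r']. *)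
transitivity ((r * r + 1) *: (c *: w') - (1 + r' * r') *: (c *: w)).
  rewrite -E -E' !scalerDr scalerN !scalerA opprD addrACA -!scalerBl -scaleNr.
  by congr (_ *: _ + _ *: _); ring.
rewrite scalerBr !scalerA.
have -> : (r * r + 1) * c = r * 2 by rewrite -c2 -rr'; ring.
have -> : (1 + r' * r') * c = r' * 2 by rewrite -c2 -rr'; ring.
by rewrite !mulNr !scaleNr opprK addrC [2 * r]mulrC [2 * r']mulrC.
Qed.

(* For a sign s: [c s i] is c_i^s, [e s i] is q^(s N_i), [q s] is q^s and [r s]
   is q^(s/2). *)
Variables (m n : nat).
Variables (c : bool -> 'I_(m + n) -> A) (e : bool -> 'I_(m + n) -> A).
Variables (r q : bool -> S) (cq : S).
Hypotheses (rK : forall s, r s * r (~~ s) = 1) (rr : forall s, r s * r s = q s).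
Hypothesis cqE : cq * (r false + r true) = 2.
Hypothesis c_lt : forall s s' (i j : 'I_(m + n)), (i < j)%N ->
  c s i ** c s' j = (- sgn (par j) * q (s (+) s')) *: (c s' j ** c s i).
Hypothesis c_diag : forall s i,
  c true i ** c false i + (sgn (par i) * q s) *: (c false i ** c true i) =
  cq *: e (s (+) par i) i.
Hypothesis c_sqr : forall s i, ~~ par i -> c s i ** c s i = 0.
Hypothesis e_comm : forall s s' i j,
  i != j -> e s i ** c s' j = c s' j ** e s i.

Lemma qK s : q s * q (~~ s) = 1.
Proof. by rewrite -!rr mulrACA rK mulr1. Qed.

(** One rule for both orders of the indices. Odd indices come first, so the parity of the larger
    index is [par i && par j]. *)
Lemma c_swap s s' (i j : 'I_(m + n)) : i != j ->
  c s i ** c s' j =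
  (- sgn (par i && par j) * q ((j < i)%N (+) (s (+) s'))) *: (c s' j ** c s i).
Proof.
have par_lt (i' j' : 'I_(m + n)) : (i' < j')%N -> par i' && par j' = par j'.
  by move=> lt_ij; apply: andb_idl; apply: ltn_trans.
rewrite -val_eqE neq_ltn => /orP[] lt_ij.
  by rewrite c_lt // par_lt // ltnNge (ltnW lt_ij).
rewrite andbC par_lt // lt_ij addTb; apply: (qswap_sym _ (c_lt _ _ lt_ij)).
by rewrite [s' (+) s]addbC; apply: qK.
Qed.

Lemma c_diag_flip s eta i :
  c (~~ eta) i ** c eta i + (sgn (par i) * q s) *: (c eta i ** c (~~ eta) i) =
  ((if eta then sgn (par i) * q s else 1) * cq) *: e (s (+) eta (+) par i) i.
Proof.
case: eta; last by rewrite addbF mul1r c_diag.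
rewrite addbT -[RHS]scalerA; have := qsum_sym (qK (~~ s)) (c_diag (~~ s) i).
by rewrite negbK.
Qed.

Lemma osp_diag_image i :
  (q false - q true) *:
    (c true i ** c false i - sgn (par i) *: (c false i ** c true i)) =
  (- 2) *: (r true *: e (par i) i - r false *: e (~~ par i) i).
Proof.
rewrite -!rr; apply: diag_qbox; [exact: (rK false) | exact: cqE | |].
  by rewrite rr c_diag.
by rewrite rr c_diag addTb.
Qed.

Lemma osp_serre_image s (i j : 'I_(m + n)) : i.+1 = j :> nat ->
  let b := c s i ** c s j - sgn (par i && par j) *: (c s j ** c s i) in
  b ** c s j - q (~~ par j) *: (c s j ** b) = 0.
Proof.
move=> ij; apply: (@serre_swap _ (par j) (q false)); last 2 first.
- exact: c_sqr.
(* If the last index is odd, so is its predecessor. *)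
- move=> pj; rewrite pj andbT; split=> //.
  by apply: leq_trans pj; rewrite ltnS -ij.
rewrite c_swap ?addbb ?addbF; last by rewrite -val_eqE /= -ij ltn_eqF.
by rewrite ltnNge -ij ltnW.
Qed.

Lemma osp_triple_image xi eta i k j : is_next xi i k ->
  let b := c eta i ** c (~~ eta) k -
           sgn (par i && par k) *: (c (~~ eta) k ** c eta i) in
  b ** c eta j - (sgn ((par i (+) par k) && par j) *
    (if i == j then q (~~ xi (+) par i) else 1)) *: (c eta j ** b) =
  (2 * sgn (eta && par j) * (j == k)%:R) *:
  ((r (xi (+) eta) *: e (~~ xi (+) eta (+) par j) j) ** c eta i).
Proof.
move=> ik b; have flip (x y : bool) : ~~ x (+) (~~ y (+) y) = x.
  by case: x y => [] [].
have [lt_ik lt_ki] : (i < k)%N = ~~ xi /\ (k < i)%N = xi.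
  by case: (xi) ik => /= [/eqP <-|/eqP ->]; rewrite ltnS leqnn ltnNge leqnSn.
have ne_ik : i != k by rewrite -val_eqE neq_ltn lt_ik lt_ki orNb.
(* The inner bracket of neighbours is a multiple of the plain product, so only the outer bracket
   remains. *)
have -> : b = (1 + q xi) *: (c eta i ** c (~~ eta) k).
  by apply: qbr_swap; rewrite c_swap 1?eq_sym // andbC lt_ik flip.
rewrite {b} qbr_scale; have [->|ne_jk] := eqVneq j k.
  rewrite (negPf ne_ik) mulr1 (@triple_next _ _ (q (~~ xi))); last first.
    by rewrite c_swap 1?eq_sym // addbb addbF lt_ik andbC.
  rewrite c_diag_flip -mZr -mZl e_comm 1?eq_sym // !scalerA mulr1.
  congr (_ *: _).
  (* The factor [q^(1/2) + q^(-1/2)] split off here cancels the denominator of [cq] and produces the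
     2 of the relation. *)
  have -> : 1 + q xi = r xi * (r false + r true).
    by rewrite -(rK xi) -rr; case: (xi); rewrite /= mulrDr // addrC.
  transitivity (r xi * (if eta then sgn (par k) * q (~~ xi) else 1) *
    (cq * (r false + r true))); first by ring.
  rewrite cqE; case: eta => /=; last by rewrite addbF expr0 !mulr1 mulrC.
  by rewrite addbT -rr -[RHS]mul1r -(rK xi); ring.
have -> : c eta i ** c (~~ eta) k ** c eta j -
    (sgn ((par i (+) par k) && par j) *
      (if i == j then q (~~ xi (+) par i) else 1)) *:
    (c eta j ** (c eta i ** c (~~ eta) k)) = 0; last first.
  by rewrite scaler0 mulr0 scale0r.
have [<-|ne_ij] := eqVneq i j.
  apply: (@triple_same _ _ (q xi)); last by move=> ->; rewrite addbT negbK.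
  - by rewrite c_swap 1?eq_sym // andbC lt_ik flip.
  - exact: c_sqr.
rewrite mulr1; apply: triple_other (c_swap _ _ _) (c_swap _ _ _) _ => //.
  by rewrite eq_sym.
(* No index lies strictly between the neighbours [i] and [k], so [j] is on the same side of both. *)
have -> : (j < k)%N = (j < i)%N.
  move: ne_ij ne_jk ik; rewrite -!val_eqE /=; case: (xi) => /= + + /eqP E; lia.
by rewrite addNb !addbb addbF addbT mulrC qK.
Qed.

End QCommutation.

(** * The osp relations in the Clifford algebra *)

Section CliffordRelations.
Variables (K : fieldType) (charK : [pchar K] =i pred0) (m n : nat).
Local Notation F := (freealg K (gens m n)).
Local Notation U := (presented (@cliff_rel K m n)).
Local Notation pi := (pres_pi (@cliff_rel K m n)).
Local Notation sgn b := ((-1) ^+ (nat_of_bool b)).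

Definition clq_c (s : bool) (i : 'I_(m + n)) : U :=
  pi (hconst (fgen K (inr (s, i) : gens m n))).
Definition clq_e (s : bool) (i : 'I_(m + n)) : U :=
  pi (qexp (sgn s *: fgen K (inl i : gens m n))).
Definition qsgn (s : bool) : hseries K := qpow (sgn s).
Definition qsgn_half (s : bool) : hseries K := qpow (sgn s * 2^-1).

Lemma qsgn_halfK s : qsgn_half s * qsgn_half (~~ s) = 1.
Proof. by rewrite /qsgn_half signrN mulNr qpowK. Qed.

Lemma qsgn_half_sqr s : qsgn_half s * qsgn_half s = qsgn s.
Proof.
rewrite /qsgn_half -qpowD // -mulrDr -mulr2n -[_^-1 *+ 2]mulr_natr.
rewrite mulVf ?mulr1 //.
by have /pcharf0P/(_ 2%N) := charK => ->.
Qed.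

Lemma cliff_constE : cliff_const K * (qsgn_half false + qsgn_half true) = 2.
Proof.
rewrite /qsgn_half expr0 expr1 mul1r mulN1r divrK // unfold_in /= /hs_unit /=.
rewrite !expr0 -[0`!]/1%N invr1 mulr1.
by have /pcharf0P/(_ 2%N) := charK => ->.
Qed.

Lemma clq_c_lt (s t : bool) (i j : 'I_(m + n)) : (i < j)%N ->
  clq_c s i * clq_c t j =
  (- sgn (par j) * qsgn (s (+) t)) *: (clq_c t j * clq_c s i).
Proof.
move=> lt_ij; rewrite /qsgn signr_addb.
have /pres_pi_rel R := @cliff_comm K m n s t i j lt_ij.
by rewrite pres_piMr pres_piZM in R.
Qed.

Lemma clq_c_diag (s : bool) (i : 'I_(m + n)) :
  clq_c true i * clq_c false i +
    (sgn (par i) * qsgn s) *: (clq_c false i * clq_c true i) =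
  cliff_const K *: clq_e (s (+) par i) i.
Proof.
rewrite /clq_e signr_addb; have /pres_pi_rel R := @cliff_diag K m n s i.
by rewrite pres_pi_lin2 pres_pi_scalable in R.
Qed.

Lemma clq_c_sqr (s : bool) (i : 'I_(m + n)) :
  ~~ par i -> clq_c s i * clq_c s i = 0.
Proof.
move=> ev; have /pres_pi_rel R := cliff_sq K s ev.
by rewrite expr2 pres_piMr raddf0 in R.
Qed.

Lemma clq_weight (s : bool) (i j : 'I_(m + n)) :
  pi (hconst (fgen K (inl i : gens m n) * fgen K (inr (s, j) : gens m n) -
              fgen K (inr (s, j) : gens m n) * fgen K (inl i : gens m n))) =
  (sgn s * (i == j)%:R) *: clq_c s j.
Proof.
have /pres_pi_rel R := @cliff_weight K m n s i j.
by rewrite pres_pi_const_comm R; apply: pres_pi_scalable.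
Qed.

Lemma clq_cart (i j : 'I_(m + n)) :
  pi (hconst (fgen K (inl i : gens m n) * fgen K (inl j : gens m n) -
              fgen K (inl j : gens m n) * fgen K (inl i : gens m n))) = 0.
Proof.
have /pres_pi_rel R := @cliff_cart K m n i j.
by rewrite pres_pi_const_comm R raddf0.
Qed.

Lemma clq_e_comm (s t : bool) (i j : 'I_(m + n)) : i != j ->
  clq_e s i * clq_c t j = clq_c t j * clq_e s i.
Proof.
move=> ne_ij; apply: pres_qexp_comm; apply/eqP; rewrite -subr_eq0.
have := pres_pi_const_comm (@cliff_rel K m n)
  (fgen K (inl i : gens m n)) (fgen K (inr (t, j) : gens m n)).
rewrite clq_weight (negPf ne_ij) mulr0 scale0r pres_pi_qbr scale1r => <-.
exact: eqxx.
Qed.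

(** The prescribed values, taken in the free algebra, before any relation is imposed. *)
Definition osp_subst (x : gens m n) : F :=
  match x with
  | inl i => sgn (par i) *: fgen K (inl i : gens m n) - (2^-1)%:A
  | inr _ => fgen K x
  end.
Local Notation P f := (pi (hmap (falift osp_subst) f)).

Lemma osp_subst_root s i : P (hconst (fgen K (inr (s, i)))) = clq_c s i.
Proof. by rewrite hmap_const /= falift_gen. Qed.

(** The shift by -1/2 is central, so it leaves the exponential as the scalar [q^(-t/2)], which is
    [qsgn_half (~~ t)]. *)
Lemma osp_subst_exp (t : bool) i :
  P (qexp (sgn t *: fgen K (inl i : gens m n))) =
  qsgn_half (~~ t) *: clq_e (t (+) par i) i.
Proof.
have sE : falift osp_subst (sgn t *: fgen K (inl i : gens m n)) =
    sgn (t (+) par i) *: fgen K (inl i : gens m n) + (sgn (~~ t) * 2^-1)%:A.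
  by rewrite falift_scalable falift_gen /= scale_affine signr_addb signrN mulNr.
by rewrite hmap_qexp /= sE; apply: pres_qexpD_scalar.
Qed.

Lemma clq_osp_cart i j :
  P (qbr 1 (hconst (fgen K (inl i))) (hconst (fgen K (inl j)))) = 0.
Proof.
(* Flipping the commutator puts the second affine expression on the left, so that [comm_affine]
   applies to it too. *)
rewrite pres_hmap_comm /= !falift_gen /= comm_affine -opprB comm_affine.
by rewrite -scalerN opprB !hconstZ !pres_pi_scalable clq_cart !scaler0.
Qed.

Lemma clq_osp_weight s i j :
  P (qbr 1 (hconst (fgen K (inl i))) (hconst (fgen K (inr (s, j))))) =
  (sgn s * (i == j)%:R * sgn (par i)) *: clq_c s j.
Proof.
rewrite pres_hmap_comm /= !falift_gen /= comm_affine hconstZ pres_pi_scalable.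
by rewrite clq_weight scalerA (rmorph_sign (@hconst K)) mulrC.
Qed.

Lemma clq_osp_diag i :
  P (sqbr (par i) (par i) 1 (hconst (fgen K (inr (true, i))))
                            (hconst (fgen K (inr (false, i))))) =
  P (- 2 *: qbox (fgen K (inl i))).
Proof.
(* Multiplying by [q - q^-1] loses nothing and turns [qbox] into a difference of exponentials. *)
apply/eqP; rewrite -subr_eq0; apply/eqP/(pres_qdiff_inj charK).
rewrite scalerBr.
apply/eqP; rewrite subr_eq0; apply/eqP.
transitivity ((qpow 1 - qpow (-1)) *: (clq_c true i * clq_c false i -
    sgn (par i) *: (clq_c false i * clq_c true i))).
  congr (_ *: _); rewrite /sqbr andbb mulr1.
  by apply: pres_hmap_qbr; apply: osp_subst_root.
have -> : qpow 1 - qpow (-1) = qsgn false - qsgn true by [].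
(* The two terms are the images of [q^(H_i)] and [q^(-H_i)]. *)
transitivity (- 2 *: (qsgn_half true *: clq_e (par i) i -
                      qsgn_half false *: clq_e (~~ par i) i)).
  exact: (osp_diag_image qsgn_halfK qsgn_half_sqr cliff_constE clq_c_diag).
have Z := @pres_hmapZ _ _ _ (@cliff_rel K m n) (falift osp_subst) (- 2)
  (qbox (fgen K (inl i))) _ erefl.
apply: etrans (congr1 (fun z => (qsgn false - qsgn true) *: z) (esym Z)).
rewrite scalerA mulrC -scalerA; congr (_ *: _).
have B := pres_hmap_qbox (@cliff_rel K m n) (falift osp_subst) charK
  (fgen K (inl i)).
apply: etrans (esym B).
have := osp_subst_exp false i; rewrite expr0 scale1r => E0.
have := osp_subst_exp true i; rewrite expr1 scaleN1r => E1.
congr (_ - _); [apply: etrans (esym E0) | apply: etrans (esym E1)];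
  exact: erefl.
Qed.

Lemma clq_osp_serre (s : bool) (i j : 'I_(m + n)) :
  i.+2 = (m + n)%N -> j.+1 = (m + n)%N ->
  P (qbr (qpow (- sgn (par j)))
         (sqbr (par i) (par j) 1 (hconst (fgen K (inr (s, i))))
                                 (hconst (fgen K (inr (s, j)))))
         (hconst (fgen K (inr (s, j))))) = 0.
Proof.
move=> iN jN; have ij : i.+1 = j :> nat by apply: succn_inj; rewrite iN jN.
have := osp_serre_image (@mulrA U) (@pres_scaleAl _ _ _) (@pres_scaleAr _ _ _)
  qsgn_halfK qsgn_half_sqr clq_c_lt clq_c_sqr s ij.
rewrite /qsgn signrN => <-; rewrite /sqbr mulr1.
by apply: pres_hmap_qbr; [apply: pres_hmap_qbr|]; apply: osp_subst_root.
Qed.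

Lemma clq_osp_triple (xi eta : bool) (i k j : 'I_(m + n)) : is_next xi i k ->
  P (sqbr (par i (+) par k) (par j)
       (qpow (- sgn xi * sgn (par i) * (i == j)%:R))
       (sqbr (par i) (par k) 1 (hconst (fgen K (inr (eta, i))))
                               (hconst (fgen K (inr (~~ eta, k)))))
       (hconst (fgen K (inr (eta, j))))) =
  P ((2%:R * sgn eta ^+ par j * (j == k)%:R) *:
     (qexp ((- sgn xi * sgn eta) *: fgen K (inl j)) *
      hconst (fgen K (inr (eta, i))))).
Proof.
move=> ik; have T := osp_triple_image (@mulrA U) (@mulrDr U)
  (@pres_scaleAl _ _ _) (@pres_scaleAr _ _ _)
  qsgn_halfK qsgn_half_sqr cliff_constE clq_c_lt clq_c_diag
  clq_c_sqr clq_e_comm eta j ik.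
have -> : sgn eta ^+ par j = sgn (eta && par j) :> hseries K.
  by rewrite -exprM mulnb.
rewrite -signrN -2!signr_addb.
have Z a := @pres_hmapZM _ _ _ (@cliff_rel K m n) (falift osp_subst) a _ _ _ _
  (osp_subst_exp (~~ xi (+) eta) j) (osp_subst_root eta i).
have xe : ~~ (~~ xi (+) eta) = xi (+) eta by case: (xi) (eta) => [] [].
rewrite xe in Z; apply: etrans _ (esym (Z _)); apply: etrans _ T.
have -> : qpow (sgn (~~ xi (+) par i) * (i == j)%:R) =
    if i == j then qsgn (~~ xi (+) par i) else 1 :> hseries K.
  by case: eqP => _; rewrite ?mulr1 ?mulr0 ?qpow0.
rewrite /sqbr mulr1.
by apply: pres_hmap_qbr; [apply: pres_hmap_qbr|]; apply: osp_subst_root.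
Qed.

Lemma clq_osp_rel (u v : tfree K (gens m n)) : osp_rel u v -> P u = P v.
Proof.
case=> [i j|s i j|i|s i j iN jN|xi eta i k j ik].
- exact: etrans (clq_osp_cart i j) (esym (pres_hmap0 _ _)).
- apply: etrans (clq_osp_weight s i j) (esym _).
  exact: pres_hmapZ _ (osp_subst_root s j).
- exact: clq_osp_diag.
- exact: etrans (clq_osp_serre s iN jN) (esym (pres_hmap0 _ _)).
- exact: clq_osp_triple.
Qed.

End CliffordRelations.

(** * The morphism *)

Lemma prod_scaler (K : comNzRingType) (A : algType K) (T : Type) (s : seq T)
    (a : T -> K) (b : T -> A) :
  \prod_(x <- s) (a x *: b x) = (\prod_(x <- s) a x) *: \prod_(x <- s) b x.
Proof.
elim: s => [|x s IHs]; first by rewrite !big_nil scale1r.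
by rewrite !big_cons IHs -scalerAl -scalerAr scalerA.
Qed.

(** * The grading as an eigenspace decomposition *)

Section FreeAlgebraGrading.
Variables (K : fieldType) (charK : [pchar K] =i pred0) (G : choiceType).
Variable deg : G -> bool.
Local Notation F := (freealg K G).

Definition parity_aut : F -> F := falift (fun x => (-1) ^+ deg x *: fgen K x).

Lemma lift_word_sign (w : {fmonom G}) :
  lift_word (fun x => (-1) ^+ deg x *: fgen K x) w =
  (-1) ^+ word_deg deg w *: (mkmalgU w 1 : F).
Proof.
by rewrite malgU_prod /lift_word prod_scaler prodrXr /word_deg signr_odd.
Qed.

Lemma mcoeff_parity_aut (f : F) w :
  mcoeff w (parity_aut f) = (-1) ^+ word_deg deg w * mcoeff w f.
Proof.
rewrite [f in RHS]monalgE /parity_aut /falift mmapE !raddf_sum /= mulr_sumr.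
apply: eq_bigr => v _; rewrite lift_word_sign mulr_algl !mcoeffZ !mcoeffU.
by have [->|] := eqVneq v w; rewrite ?mulr0 // !mulr1n mulr1 mulrC.
Qed.

(** Homogeneity becomes an eigenvector condition, which any morphism commuting with [parity_aut]
    preserves. The converse direction needs [1 != -1]. *)
Lemma parity_autP (d : bool) (f : F) :
  (forall w, w \in msupp f -> word_deg deg w = d) <->
  parity_aut f = (-1) ^+ d *: f.
Proof.
split=> [f_d|f_d w].
  apply/malgP => w; rewrite mcoeff_parity_aut mcoeffZ.
  have [/f_d -> //|/mcoeff_outdom ->] := boolP (w \in msupp f).
  by rewrite !mulr0.
rewrite -mcoeff_neq0 => fw0; have := mcoeff_parity_aut f w.
rewrite f_d mcoeffZ => /(mulIf fw0).
have nz2 : 1 + 1 != 0 :> K by have /pcharf0P/(_ 2%N) := charK => ->.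
have sgn_inj : injective (fun b : bool => (-1) ^+ b : K).
  move=> [] [] //; rewrite expr0 expr1 => /eqP;
    by rewrite ?[- 1 == _]eq_sym -subr_eq0 opprK (negPf nz2).
by move=> E; apply/esym/sgn_inj.
Qed.

End FreeAlgebraGrading.

Lemma lrmorph_affine (K : nzRingType) (A B : algType K)
    (h : {lrmorphism A -> B}) (s c : K) (x : A) :
  h (s *: x - c%:A) = s *: h x - c%:A.
Proof. by rewrite rmorphB /= !linearZ /= rmorph1. Qed.

(** * Morphisms are determined by their values on generators *)

Section FreeAlgebraMorphisms.
Variables (K : fieldType) (G : choiceType) (A : algType K).

Lemma freealg_morph_ext (p p' : {lrmorphism freealg K G -> A}) :
  (forall x, p (fgen K x) = p' (fgen K x)) -> p =1 p'.
Proof.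
move=> pp'; elim/freealg_ind => [|f g E E'|c f E||f g E E'|//].
- by rewrite !raddf0.
- by rewrite !raddfD /= E E'.
- by rewrite !linearZ /= E.
- by rewrite !rmorph1.
- by rewrite !rmorphM /= E E'.
Qed.

End FreeAlgebraMorphisms.

Section PresentedMorphisms.
Variables (K : fieldType) (G G' : choiceType).
Variable rel : tfree K G -> tfree K G -> Prop.
Variable rel' : tfree K G' -> tfree K G' -> Prop.

Lemma pres_morph_ext (p p' : {rmorphism presented rel -> presented rel'}) :
  scalable p -> scalable p' ->
  (forall x, p (pres_gen rel x) = p' (pres_gen rel x)) -> p =1 p'.
Proof.
move=> pZ p'Z pp'.
have E (y : freealg K G) :
    p (pres_pi rel (hconst y)) = p' (pres_pi rel (hconst y)).
  pose c := pres_pi rel \o @hconst (freealg K G) : {rmorphism _ -> _}.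
  rewrite -[pres_pi rel _]/(c y).
  have cZ a f : c (a *: f) = hconst a *: c f.
    by rewrite /c /= hconstZ pres_pi_scalable.
  elim/freealg_ind: y => [|f g Ef Eg|a f Ef||f g Ef Eg|x].
  - by rewrite !rmorph0.
  - by rewrite !rmorphD Ef Eg.
  - by rewrite cZ pZ p'Z Ef.
  - by rewrite !rmorph1.
  - by rewrite !rmorphM Ef Eg.
  - exact: pp'.
move=> x; have [f <-] := pres_pi_surj x.
apply/eqP; rewrite -subr_eq0; apply/eqP.
apply: pres_separated => k.
(* On the polynomial part of [f] both morphisms agree, so their difference at [f] is [h^k] times
   their difference at this tail. *)
pose g := HSeries (fun l => hcoef f (k + l)%N).
exists (p (pres_pi rel g) - p' (pres_pi rel g)).
have fE : pres_pi rel f =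
    \sum_(l < k) hvar K ^+ l *: pres_pi rel (hconst (hcoef f l)) +
    hvar K ^+ k *: pres_pi rel g.
  rewrite {1}(hs_expansion f k) pres_piD pres_pi_scalable raddf_sum /=.
  apply: (congr1 (fun z => z + _)); apply: eq_bigr => l _.
  exact: pres_pi_scalable.
rewrite fE !rmorphD /= pZ p'Z scalerBr !raddf_sum /=.
suff -> : \sum_(l < k) p (hvar K ^+ l *: pres_pi rel (hconst (hcoef f l))) =
    \sum_(l < k) p' (hvar K ^+ l *: pres_pi rel (hconst (hcoef f l))).
  by rewrite opprD addrACA subrr add0r.
by apply: eq_bigr => l _; rewrite pZ p'Z E.
Qed.

End PresentedMorphisms.

(** * The substitution: right inverse and compatibility with the grading *)

Section OspSubstitution.
Variables (K : fieldType) (charK : [pchar K] =i pred0) (m n : nat).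
Local Notation F := (freealg K (gens m n)).

(** Solves the substitution for [N_i], giving the preimages needed for surjectivity. *)
Definition osp_unsubst (x : gens m n) : F :=
  match x with
  | inl i => (-1) ^+ par i *: (fgen K (inl i : gens m n) + (2^-1)%:A)
  | inr _ => fgen K x
  end.

Lemma osp_unsubstK : cancel (falift osp_unsubst) (falift (@osp_subst K m n)).
Proof.
apply: (freealg_morph_ext
  (p := falift (@osp_subst K m n) \o falift osp_unsubst) (p' := idfun)).
case=> [i|[s i]] /=; rewrite falift_gen /=; last by rewrite falift_gen.
rewrite falift_scalable rmorphD /= falift_gen /= falift_scalable rmorph1.
by rewrite subrK scalerA -expr2 sqrr_sign scale1r.
Qed.

Lemma osp_subst_parity (f : F) :
  parity_aut (@gens_deg m n) (falift (@osp_subst K m n) f) =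
  falift (@osp_subst K m n) (parity_aut (@gens_deg m n) f).
Proof.
move: f; apply: (freealg_morph_ext
  (p := falift _ \o falift _) (p' := falift _ \o falift _)).
case=> [i|[s i]] /=; rewrite !falift_gen /=.
  apply: etrans (lrmorph_affine (falift _) _ _ _) _.
  by rewrite /= falift_gen falift_scalable falift_gen /= !expr0 !scale1r.
by rewrite !falift_scalable !falift_gen.
Qed.

Lemma osp_subst_homog d (f : tfree K (gens m n)) :
  tfree_homog (@gens_deg m n) d f ->
  tfree_homog (@gens_deg m n) d (hmap (falift (@osp_subst K m n)) f).
Proof.
move=> f_d k; apply/(parity_autP charK); rewrite /= osp_subst_parity.
by have /(parity_autP charK) -> := f_d k; rewrite falift_scalable.
Qed.

End OspSubstitution.

(** * The homomorphism onto the Clifford superalgebra *)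

Section OspToClifford.
Variables (K : fieldType) (charK : [pchar K] =i pred0) (m n : nat).

Lemma clq_osp_H (i : 'I_(m + n)) :
  pres_pi (@cliff_rel K m n)
    (hmap (falift (@osp_subst K m n)) (hconst (fgen K (inl i)))) =
  (-1) ^+ par i *: cliff_N K i - 2^-1 *: (1 : Clq K m n).
Proof.
have E2 : hconst (2^-1) = 2^-1 :> hseries K.
  by rewrite (fmorphV (@hconst K)) (rmorph_nat (@hconst K)).
have Es (b : bool) : hconst ((-1) ^+ b) = (-1) ^+ b :> hseries K.
  exact: (rmorph_sign (@hconst K)).
rewrite hmap_const /= falift_gen /= hconst_affine E2 Es.
exact: pres_pi_affine.
Qed.

Lemma Uq_osp_Clq_morphism :
  exists phi : {rmorphism Uq_osp K m n -> Clq K m n},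
    [/\
        [/\ scalable phi,
            forall s i, phi (osp_a K s i) = cliff_c K s i &
            forall i, phi (osp_H K i) =
              (-1) ^+ par i *: cliff_N K i - 2^-1 *: (1 : Clq K m n)],
        forall psi : {rmorphism Uq_osp K m n -> Clq K m n},
          scalable psi ->
          (forall s i, psi (osp_a K s i) = cliff_c K s i) ->
          (forall i, psi (osp_H K i) =
             (-1) ^+ par i *: cliff_N K i - 2^-1 *: (1 : Clq K m n)) ->
          psi =1 phi,
        forall d (x : Uq_osp K m n), osp_homog d x -> cliff_homog d (phi x) &
        forall y, exists x, phi x = y].
Proof.
have [phi phiZ phiE] := pres_map_exists (@clq_osp_rel K charK m n).
have phi_a s i : phi (osp_a K s i) = cliff_c K s i.
  by rewrite /osp_a /pres_gen phiE osp_subst_root.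
have phi_H i : phi (osp_H K i) =
    (-1) ^+ par i *: cliff_N K i - 2^-1 *: (1 : Clq K m n).
  by rewrite /osp_H /pres_gen phiE clq_osp_H.
exists phi; split; first by split.
- move=> psi psiZ psi_a psi_H; apply: (pres_morph_ext psiZ phiZ).
  case=> [i|[s i]]; first exact: etrans (psi_H i) (esym (phi_H i)).
  exact: etrans (psi_a s i) (esym (phi_a s i)).
- move=> d x [f f_d <-]; exists (hmap (falift (@osp_subst K m n)) f).
    exact: osp_subst_homog.
  exact: esym (phiE f).
- move=> y; have [f <-] := pres_pi_surj y.
  (* The preimage is found at the level of series; no relation has to be respected by the inverse
     substitution. *)
  exists (pres_pi _ (hmap (falift (@osp_unsubst K m n)) f)).
  apply: etrans (phiE _) _; congr pres_pi.
  by apply: hseriesP => k /=; apply: osp_unsubstK.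
Qed.

End OspToClifford.

Theorem proposition6 (R : realType) (m n : nat) (mn_gt0 : (0 < m + n)%N) :
  exists phi : {rmorphism Uq_osp R[i] m n -> Clq R[i] m n},
    [/\ (* phi is C[[h]]-linear and takes the prescribed values *)
        [/\ scalable phi,
            forall s i, phi (osp_a R[i] s i) = cliff_c R[i] s i &
            forall i, phi (osp_H R[i] i) =
              (-1) ^+ par i *: cliff_N R[i] i - 2^-1 *: (1 : Clq R[i] m n)],
        (* it is the only such homomorphism *)
        forall psi : {rmorphism Uq_osp R[i] m n -> Clq R[i] m n},
          scalable psi ->
          (forall s i, psi (osp_a R[i] s i) = cliff_c R[i] s i) ->
          (forall i, psi (osp_H R[i] i) =
             (-1) ^+ par i *: cliff_N R[i] i - 2^-1 *: (1 : Clq R[i] m n)) ->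
          psi =1 phi,
        (* it preserves the Z/2-grading *)
        forall d x, osp_homog d x -> cliff_homog d (phi x) &
        (* it is onto *)
        forall y, exists x, phi x = y].
Proof. by apply: Uq_osp_Clq_morphism; apply: Num.Theory.pchar_num. Qed.
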